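(* Let $k\ge1$ and let $\mathcal{L}^N\subset C^\infty(S^1,\mathbb{R})$ be any vector subspace of dimension $N$ with $k\le N\le 2k-2$. Then there exists an equilevel algebra $\mathcal{F}$ of codimension $k$ in $C^\infty(S^1,\mathbb{R})$ such that $\dim(\mathcal{F}\cap\mathcal{L}^N)>N-k$.
   Context: Let $S^1=\mathbb{R}/2\pi\mathbb{Z}$. For $k\ge 1$ let $F(S^1,2k)\subset (S^1)^{2k}$ be the set of sequences $(x_1,\tilde x_1;\dots;x_k,\tilde x_k)$ of $2k$ pairwise distinct points; such a sequence defines the subalgebra $\{f\in C^\infty(S^1,\mathbb{R}): f(x_i)=f(\tilde x_i)\ \forall i\}$. Given an algebraic parametric curve germ $\nu:[0,\varepsilon)\to (S^1)^{2k}$ with $\nu(t)\in F(S^1,2k)$ for $t\in(0,\varepsilon)$, let $\mathcal{F}_t$ be the subalgebra defined by $\nu(t)$, and let $\mathcal{F}_0$ be the set of all $f$ for which there exists a family $f_t$, $t\in[0,\varepsilon)$, continuous in the $C^{2k}$ topology, with $f_0=f$ and $f_t\in\mathcal{F}_t$ for $t>0$. Such subalgebras $\mathcal{F}_0$ are the equilevel algebras of codimension $k$. *)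

(* Defs.v *)
From Stdlib Require Import Reals Lra ZArith.
From Coquelicot Require Import Coquelicot.
Open Scope R_scope.

(* Functions on S^1 = R/2piZ are represented as 2pi-periodic functions R -> R. *)
Definition periodic (f : R -> R) : Prop := forall x, f (x + 2 * PI) = f x.

Definition smooth_circle (f : R -> R) : Prop :=
  periodic f /\ forall (n : nat) (x : R), ex_derive_n f n x.

Definition distinct_S1 (x y : R) : Prop := forall n : Z, x - y <> 2 * PI * IZR n.

(* A configuration nu t : nat -> R (lifted coordinates; coordinates 2i and 2i+1
   are x_{i+1} and ~x_{i+1}, for i < k) is in F(S^1, 2k). *)
Definition in_config (k : nat) (c : nat -> R) : Prop :=
  forall i j, (i < 2 * k)%nat -> (j < 2 * k)%nat -> i <> j -> distinct_S1 (c i) (c j).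

Definition alg_of_config (k : nat) (c : nat -> R) (f : R -> R) : Prop :=
  smooth_circle f /\ forall i, (i < k)%nat -> f (c (2 * i)%nat) = f (c (2 * i + 1)%nat).

Definition poly2 (d : nat) (a : nat -> nat -> R) (t y : R) : R :=
  sum_f_R0 (fun i => sum_f_R0 (fun j => a i j * t ^ i * y ^ j) d) d.

Definition poly2_nonzero (d : nat) (a : nat -> nat -> R) : Prop :=
  exists i j, (i <= d)%nat /\ (j <= d)%nat /\ a i j <> 0.

Definition algebraic_on (eps : R) (c : R -> R) : Prop :=
  exists d a, poly2_nonzero d a /\ forall t, 0 <= t < eps -> poly2 d a t (c t) = 0.

Definition continuous_on_Ico (eps : R) (c : R -> R) : Prop :=
  forall t0, 0 <= t0 < eps -> forall e, e > 0 -> exists delta, delta > 0 /\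
    forall t, 0 <= t < eps -> Rabs (t - t0) < delta -> Rabs (c t - c t0) < e.

(* nu : [0,eps) -> (S^1)^{2k} is an algebraic parametric curve (germ):
   nu is given by a continuous lift, and, viewing S^1 as the unit circle in R^2,
   all coordinates cos(nu_j(t)), sin(nu_j(t)) are algebraic functions of t. *)
Definition algebraic_curve (k : nat) (eps : R) (nu : R -> nat -> R) : Prop :=
  forall j, (j < 2 * k)%nat ->
    continuous_on_Ico eps (fun t => nu t j) /\
    algebraic_on eps (fun t => cos (nu t j)) /\
    algebraic_on eps (fun t => sin (nu t j)).

Definition Cm_continuous_family (m : nat) (eps : R) (fam : R -> R -> R) : Prop :=
  forall t0, 0 <= t0 < eps -> forall e, e > 0 -> exists delta, delta > 0 /\
    forall t, 0 <= t < eps -> Rabs (t - t0) < delta ->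
      forall (r : nat) (x : R), (r <= m)%nat ->
        Rabs (Derive_n (fam t) r x - Derive_n (fam t0) r x) < e.

Definition limit_algebra (k : nat) (eps : R) (nu : R -> nat -> R) (f : R -> R) : Prop :=
  smooth_circle f /\
  exists fam : R -> R -> R,
    (forall t, 0 <= t < eps -> smooth_circle (fam t)) /\
    Cm_continuous_family (2 * k) eps fam /\
    (forall x, fam 0 x = f x) /\
    (forall t, 0 < t < eps -> alg_of_config k (nu t) (fam t)).

Definition equilevel_algebra (k : nat) (F : (R -> R) -> Prop) : Prop :=
  exists (eps : R) (nu : R -> nat -> R),
    eps > 0 /\ algebraic_curve k eps nu /\
    (forall t, 0 < t < eps -> in_config k (nu t)) /\
    (forall f, F f <-> limit_algebra k eps nu f).

Fixpoint rsum (m : nat) (F : nat -> R) : R :=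
  match m with O => 0 | S m' => rsum m' F + F m' end.

Definition lin_indep (m : nat) (h : nat -> R -> R) : Prop :=
  forall c : nat -> R,
    (forall x, rsum m (fun i => c i * h i x) = 0) ->
    forall i, (i < m)%nat -> c i = 0.

Definition in_span (N : nat) (g : nat -> R -> R) (f : R -> R) : Prop :=
  exists c : nat -> R, forall x, f x = rsum N (fun i => c i * g i x).

(* Main.v *)
Require Import Defs.
From Stdlib Require Import Reals Lra Lia Arith List Permutation Btauto Bool.
From Stdlib Require Import FunctionalExtensionality Classical IndefiniteDescription.
From Coquelicot Require Import Coquelicot.
Import ListNotations.
Open Scope R_scope.

(** A combination of chord functionals [f(x_i) - f(y_i)] annihilating [L^N] is
    found with all coefficients equal to 1 and with distinct points, so that no
    degeneration is needed and the curve can be taken constant.  Apply the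
    Hobby-Rice theorem to the [N + 1] measures [dg_0, ..., dg_{N-1}, dx] on
    [0, 2 PI]: some step function with values 1 and -1 on at most [N + 2]
    intervals is orthogonal to all of them.  Orthogonality to [dx] forces a sign
    change, and summation by parts turns orthogonality to [dg_i] into
    [sum_l (-1)^l g_i(z_l) = 0] over the cyclic sign changes [z_l], whose number
    is even, positive and at most [N + 2 <= 2 k].  Pairing consecutive [z_l] gives
    dependent chords, hence [k - 1] of the [k] chord conditions define
    [F cap L^N].

    Hobby-Rice is the Borsuk-Ulam theorem on the l1-sphere of signed lengths.
    The latter is proved by Ky Fan's parity argument on mod 2 chains of small
    simplices, the hemispheres being built by prisms over joins with a pole. *)

(** * Mod 2 chains *)

(** A simplex is a list of vertices and a cochain is a boolean function on lists. This is the
    coboundary of [F]: its mod 2 sum over the faces obtained by deleting one vertex. *)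
Fixpoint face_sum {A} (F : list A -> bool) (l : list A) : bool :=
  match l with
  | [] => false
  | x :: l' => xorb (F l') (face_sum (fun k => F (x :: k)) l')
  end.

(** The pairing of a cochain with a chain. Chains are known only through it, so repeated simplices
    cancel, and [h] is a cycle when every [face_sum G] evaluates to [false] on it. *)
Fixpoint eval {A} (F : list A -> bool) (h : list (list A)) : bool :=
  match h with
  | [] => false
  | s :: h' => xorb (F s) (eval F h')
  end.

Lemma face_sum_ext_in {A} (F G : list A -> bool) l :
  (forall k, incl k l -> S (length k) = length l -> F k = G k) ->
  face_sum F l = face_sum G l.
Proof.
  revert F G; induction l as [|x l IH]; intros F G H; [reflexivity|]; simpl.
  rewrite H; [|now intros y Hy; right | reflexivity].
  f_equal; apply IH; intros k Hk Hlen; apply H.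
  - intros y [->|Hy]; [now left | right; auto].
  - simpl; auto.
Qed.

Lemma face_sum_ext {A} (F G : list A -> bool) l :
  (forall k, F k = G k) -> face_sum F l = face_sum G l.
Proof. intros H; apply face_sum_ext_in; auto. Qed.

Lemma face_sum_xorb {A} (F G : list A -> bool) l :
  face_sum (fun k => xorb (F k) (G k)) l = xorb (face_sum F l) (face_sum G l).
Proof.
  revert F G; induction l as [|x l IH]; intros F G; simpl; [reflexivity|].
  rewrite IH; btauto.
Qed.

Lemma face_sum_andb {A} (b : bool) (F : list A -> bool) l :
  face_sum (fun k => b && F k) l = b && face_sum F l.
Proof.
  revert F; induction l as [|x l IH]; intros F; simpl; [btauto|].
  rewrite (IH (fun k => F (x :: k))); btauto.
Qed.

Lemma face_sum_map {A B} (f : A -> B) (F : list B -> bool) l :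
  face_sum F (map f l) = face_sum (fun k => F (map f k)) l.
Proof.
  revert F; induction l as [|x l IH]; intros F; simpl; [reflexivity|].
  now rewrite IH.
Qed.

Lemma face_sum_perm {A} (F : list A -> bool) l l' :
  (forall k k', Permutation k k' -> F k = F k') ->
  Permutation l l' -> face_sum F l = face_sum F l'.
Proof.
  intros HF H; revert F HF; induction H; intros F HF; simpl.
  - reflexivity.
  - rewrite (HF _ _ H); f_equal; apply IHPermutation; intros; apply HF; auto.
  - rewrite (face_sum_ext (fun k => F (y :: x :: k)) (fun k => F (x :: y :: k)));
      [btauto|]; intros; apply HF; constructor.
  - rewrite IHPermutation1; auto.
Qed.

Lemma eval_ext_in {A} (F G : list A -> bool) h :
  (forall s, In s h -> F s = G s) -> eval F h = eval G h.
Proof.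
  induction h as [|s h IH]; intros H; simpl; [reflexivity|].
  rewrite H, IH; auto; [intros; apply H|]; now (left + right).
Qed.

Lemma eval_app {A} (F : list A -> bool) h h' :
  eval F (h ++ h') = xorb (eval F h) (eval F h').
Proof. induction h as [|s h IH]; simpl; [btauto|]; rewrite IH; btauto. Qed.

Lemma eval_map {A B} (f : list A -> list B) (F : list B -> bool) h :
  eval F (map f h) = eval (fun s => F (f s)) h.
Proof. induction h as [|s h IH]; simpl; [reflexivity|]; now rewrite IH. Qed.

Lemma eval_xorb {A} (F G : list A -> bool) h :
  eval (fun s => xorb (F s) (G s)) h = xorb (eval F h) (eval G h).
Proof. induction h as [|s h IH]; simpl; [reflexivity|]; rewrite IH; btauto. Qed.

Lemma eval_flat_map {A B} (f : list A -> list (list B)) (F : list B -> bool) h :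
  eval F (flat_map f h) = eval (fun s => eval F (f s)) h.
Proof.
  induction h as [|s h IH]; simpl; [reflexivity|]; now rewrite eval_app, IH.
Qed.

Lemma eval_true {A} (F : list A -> bool) h :
  eval F h = true -> exists s, In s h /\ F s = true.
Proof.
  induction h as [|s h IH]; simpl; [discriminate|].
  destruct (F s) eqn:E; [exists s; auto|].
  destruct (eval F h); [|discriminate]; intros _.
  destruct (IH eq_refl) as [s' [? ?]]; exists s'; auto.
Qed.

(** The standard triangulation of a prism with bottom [map f s] and top [map g s]: each simplex
    follows [f] up to some vertex, then [g] from that same vertex on. *)
Fixpoint prism {A B} (f g : A -> B) (s : list A) : list (list B) :=
  match s with
  | [] => []
  | x :: l => (f x :: g x :: map g l) :: map (cons (f x)) (prism f g l)
  end.

Lemma in_prism {A B} (f g : A -> B) s u : In u (prism f g s) ->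
  length u = S (length s) /\
  forall p, In p u -> exists x, In x s /\ (p = f x \/ p = g x).
Proof.
  revert u; induction s as [|x s IH]; simpl; intros u; [tauto|].
  intros [<-|H].
  - split; [simpl; now rewrite length_map|].
    intros p [<-|[<-|Hp]]; [exists x; auto | exists x; auto |].
    apply in_map_iff in Hp; destruct Hp as [y [<- Hy]]; exists y; auto.
  - apply in_map_iff in H; destruct H as [v [<- Hv]].
    destruct (IH v Hv) as [Hl Hp]; split; [simpl; now rewrite Hl|].
    intros p [<-|H]; [exists x; auto|].
    destruct (Hp p H) as [y [? ?]]; exists y; auto.
Qed.

(** The chain homotopy formula mod 2: the boundary of a prism consists of the top, the bottom and
    the prisms over the faces; inner walls occur twice. *)
Lemma prism_boundary {A B} (f g : A -> B) (F : list B -> bool) s :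
  eval (face_sum F) (prism f g s) =
  xorb (xorb (F (map g s)) (F (map f s)))
       (face_sum (fun u => eval F (prism f g u)) s).
Proof.
  revert F; induction s as [|x s IH]; intros F; [simpl; btauto|].
  cbn [prism eval face_sum map]; rewrite eval_map; cbn [face_sum].
  rewrite eval_xorb, IH, face_sum_map.
  rewrite (face_sum_ext (fun k => xorb (F (f x :: g x :: map g k))
             (eval F (map (cons (f x)) (prism f g k))))
           (fun k => xorb (F (f x :: g x :: map g k))
             (eval (fun v => F (f x :: v)) (prism f g k))))
    by (intros; now rewrite eval_map).
  rewrite face_sum_xorb; btauto.
Qed.

Lemma prism_cycle_boundary {A B} (f g : A -> B) (F : list B -> bool) h :
  (forall G, eval (face_sum G) h = false) ->
  eval (face_sum F) (flat_map (prism f g) h) =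
  xorb (eval (fun s => F (map g s)) h) (eval (fun s => F (map f s)) h).
Proof.
  intros H; rewrite eval_flat_map.
  rewrite (eval_ext_in _ _ h (fun s _ => prism_boundary f g F s)).
  rewrite !eval_xorb, (H (fun u => eval F (prism f g u))); btauto.
Qed.

(** Prisms are stacked on a cycle: the sides cancel, the intermediate levels telescope, and only the
    two ends remain. *)
Lemma steps_boundary {A B} (f : nat -> A -> B) (F : list B -> bool) h K :
  (forall G, eval (face_sum G) h = false) ->
  eval (face_sum F) (concat (map (fun j => flat_map (prism (f j) (f (S j))) h) (seq 0 K))) =
  xorb (eval (fun s => F (map (f K) s)) h) (eval (fun s => F (map (f O) s)) h).
Proof.
  intros H; induction K as [|K IH]; [simpl; btauto|].
  rewrite seq_S, map_app, concat_app, eval_app, IH; simpl.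
  rewrite app_nil_r, prism_cycle_boundary; auto; btauto.
Qed.

(** * Signed labels *)

Definition opp_label (x : nat * bool) : nat * bool := (fst x, negb (snd x)).

(** Excludes a complementary pair, that is, two labels with equal absolute value and opposite
    signs. *)
Definition coherent (l : list (nat * bool)) : Prop :=
  forall x y, In x l -> In y l -> fst x = fst y -> snd x = snd y.

(* Ky Fan's condition: the labels have pairwise distinct absolute values and,
   sorted by absolute value, alternate in sign, the smallest one being
   positive; so the sign of the largest is the parity of their number. *)
Fixpoint alternating (m : nat) (l : list (nat * bool)) : bool :=
  match m with
  | O => match l with [] => true | _ => false end
  | S m' =>
      match filter (fun x => Nat.eqb (fst x) m') l with
      | [] => alternating m' l
      | [x] => eqb (snd x) (Nat.odd (length l)) &&
               alternating m' (filter (fun x => negb (Nat.eqb (fst x) m')) l)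
      | _ => false
      end
  end.

Lemma filter_perm {A} (f : A -> bool) l l' :
  Permutation l l' -> Permutation (filter f l) (filter f l').
Proof.
  induction 1; simpl.
  - constructor.
  - destruct (f x); auto.
  - destruct (f x), (f y); auto; constructor.
  - etransitivity; eauto.
Qed.

Lemma filter_perm_app {A} (f : A -> bool) l :
  Permutation l (filter f l ++ filter (fun x => negb (f x)) l).
Proof.
  induction l as [|x l IH]; simpl; [constructor|].
  destruct (f x); simpl; [now constructor|].
  now apply Permutation_cons_app.
Qed.

Lemma alternating_perm m l l' :
  Permutation l l' -> alternating m l = alternating m l'.
Proof.
  revert l l'; induction m as [|m IH]; intros l l' H; simpl.
  - destruct l; [now rewrite (Permutation_nil H)|].
    destruct l'; [|reflexivity]; symmetry in H; now apply Permutation_nil in H.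
  - pose proof (filter_perm (fun x => Nat.eqb (fst x) m) _ _ H) as HA.
    rewrite (IH _ _ H), (Permutation_length H), (IH _ _ (filter_perm _ _ _ H)).
    destruct (filter (fun x => Nat.eqb (fst x) m) l) as [|x [|y A]].
    + now rewrite (Permutation_nil HA).
    + now rewrite (Permutation_length_1_inv HA).
    + destruct (filter (fun x => Nat.eqb (fst x) m) l') as [|x' [|y' A']]; auto;
        apply Permutation_length in HA; discriminate.
Qed.

(** The absolute values are distinct and below [m]. This is what finally rules out an alternating
    simplex of dimension [m]. *)
Lemma alternating_length m l : alternating m l = true -> (length l <= m)%nat.
Proof.
  revert l; induction m as [|m IH]; intros l; simpl.
  - destruct l; [auto|discriminate].
  - pose proof (Permutation_length
      (filter_perm_app (fun x : nat * bool => Nat.eqb (fst x) m) l)) as E.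
    rewrite length_app in E.
    destruct (filter (fun x => Nat.eqb (fst x) m) l) as [|x [|y A]].
    + intros H; apply IH in H; lia.
    + intros H; apply andb_prop in H; destruct H as [_ H]; apply IH in H.
      simpl in E; lia.
    + discriminate.
Qed.

Lemma alternating_nil m : alternating m [] = true.
Proof. induction m; auto. Qed.

Lemma filter_level_none m (l : list (nat * bool)) :
  (forall x, In x l -> (fst x < m)%nat) ->
  filter (fun x => Nat.eqb (fst x) m) l = [].
Proof.
  induction l as [|x l IH]; simpl; intros H; [reflexivity|].
  replace (Nat.eqb (fst x) m) with false; [apply IH; auto|].
  symmetry; apply Nat.eqb_neq; specialize (H x (or_introl eq_refl)); lia.
Qed.

Lemma filter_level_all m (l : list (nat * bool)) :
  (forall x, In x l -> (fst x < m)%nat) ->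
  filter (fun x => negb (Nat.eqb (fst x) m)) l = l.
Proof.
  induction l as [|x l IH]; simpl; intros H; [reflexivity|].
  replace (Nat.eqb (fst x) m) with false; [simpl; f_equal; apply IH; auto|].
  symmetry; apply Nat.eqb_neq; specialize (H x (or_introl eq_refl)); lia.
Qed.

Lemma alternating_below m l : (forall x, In x l -> (fst x < m)%nat) ->
  alternating (S m) l = alternating m l.
Proof. intros H; simpl; now rewrite filter_level_none. Qed.

Lemma alternating_top m x l : fst x = m -> (forall y, In y l -> (fst y < m)%nat) ->
  alternating (S m) (x :: l) =
  eqb (snd x) (Nat.odd (S (length l))) && alternating m l.
Proof.
  intros Hx H; cbn [alternating filter]; rewrite Hx, Nat.eqb_refl; cbn [negb length].
  now rewrite filter_level_none, filter_level_all.
Qed.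

Lemma alternating_top2 m x y l : fst x = m -> fst y = m ->
  alternating (S m) (x :: y :: l) = false.
Proof.
  intros Hx Hy; cbn [alternating filter]; now rewrite Hx, Hy, Nat.eqb_refl.
Qed.

(** The local step of Ky Fan's theorem: the number of alternating faces has the parity of the number
    of alternating lists among [l] and its opposite. The induction splits off the labels of largest
    absolute value. *)
Lemma alternating_boundary m l :
  coherent l -> (forall x, In x l -> (fst x < m)%nat) ->
  face_sum (alternating m) l =
  xorb (alternating m l) (alternating m (map opp_label l)).
Proof.
  revert l; induction m as [|m IH]; intros l Hc Hb.
  { destruct l as [|x l]; [reflexivity|].
    specialize (Hb x (or_introl eq_refl)); lia. }
  set (f := fun x : nat * bool => Nat.eqb (fst x) m).
  pose proof (filter_perm_app f l) as HP.
  assert (HA : forall x, In x (filter f l) -> In x l /\ fst x = m).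
  { intros x Hx; apply filter_In in Hx; destruct Hx as [? Hx]; split; auto.
    now apply Nat.eqb_eq in Hx. }
  assert (HB : forall x, In x (filter (fun x => negb (f x)) l) ->
               In x l /\ (fst x < m)%nat).
  { intros x Hx; apply filter_In in Hx; destruct Hx as [Hl Hx]; split; auto.
    apply negb_true_iff, Nat.eqb_neq in Hx; specialize (Hb x Hl); lia. }
  rewrite (face_sum_perm _ _ _ (alternating_perm (S m)) HP).
  rewrite (alternating_perm (S m) _ _ HP).
  rewrite (alternating_perm (S m) _ _ (Permutation_map opp_label HP)).
  set (B := filter (fun x => negb (f x)) l) in *.
  assert (HcB : coherent B) by (intros x y Hx Hy; apply Hc; now apply HB).
  assert (HlB : forall x, In x B -> (fst x < m)%nat) by (intros; now apply HB).
  assert (HlB' : forall x, In x (map opp_label B) -> (fst x < m)%nat).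
  { intros x Hx; apply in_map_iff in Hx; destruct Hx as [y [<- Hy]].
    simpl; auto. }
  destruct (filter f l) as [|x [|y A]].
  - simpl app.
    rewrite !alternating_below by auto.
    rewrite <- IH by auto.
    apply face_sum_ext_in; intros k Hk _; apply alternating_below; auto.
  - assert (Hx : fst x = m) by now apply HA; left.
    cbn [app map face_sum].
    rewrite alternating_below, !alternating_top, length_map by auto.
    (* A face that keeps [x] has one label fewer than the whole list, so the sign demanded of [x] is
       reversed there. *)
    rewrite (face_sum_ext_in _
      (fun k => eqb (snd x) (Nat.odd (length B)) && alternating m k)).
    + rewrite face_sum_andb, IH by auto.
      rewrite Nat.odd_succ, <- Nat.negb_odd; unfold opp_label; simpl.
      destruct (snd x), (Nat.odd (length B)); simpl; btauto.
    + intros k Hk Hlen; rewrite alternating_top, Hlen by auto; reflexivity.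
  - destruct (HA x (or_introl eq_refl)) as [Hxl Hx].
    destruct (HA y (or_intror (or_introl eq_refl))) as [Hyl Hy].
    (* By coherence the two top labels coincide. The faces omitting one or the other are then equal
       and cancel, and every other face repeats the top label. *)
    assert (E : x = y).
    { destruct x as [i b], y as [j c]; simpl in *; subst i j.
      f_equal; now apply (Hc (m, b) (m, c)). }
    subst y; cbn [app map face_sum].
    rewrite !alternating_top2 by auto.
    rewrite (face_sum_ext _ (fun k => false && true))
      by (intros; now apply alternating_top2).
    rewrite face_sum_andb; btauto.
Qed.

(** * Finite sums *)

Lemma rsum_ext m F G : (forall i, (i < m)%nat -> F i = G i) -> rsum m F = rsum m G.
Proof.
  induction m as [|m IH]; intros H; simpl; [reflexivity|].
  rewrite IH, H; auto.
Qed.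

Lemma rsum_plus m F G : rsum m (fun i => F i + G i) = rsum m F + rsum m G.
Proof. induction m as [|m IH]; simpl; [ring|]; rewrite IH; ring. Qed.

Lemma rsum_scal m a F : rsum m (fun i => a * F i) = a * rsum m F.
Proof. induction m as [|m IH]; simpl; [ring|]; rewrite IH; ring. Qed.

Lemma rsum_zero m F : (forall i, (i < m)%nat -> F i = 0) -> rsum m F = 0.
Proof.
  induction m as [|m IH]; intros H; simpl; [ring|]; rewrite IH, H; auto; ring.
Qed.

Lemma rsum_le m F G : (forall i, (i < m)%nat -> F i <= G i) -> rsum m F <= rsum m G.
Proof.
  induction m as [|m IH]; intros H; simpl; [lra|].
  apply Rplus_le_compat; auto.
Qed.

Lemma rsum_nonneg m F : (forall i, (i < m)%nat -> 0 <= F i) -> 0 <= rsum m F.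
Proof.
  induction m as [|m IH]; intros H; simpl; [lra|].
  apply Rplus_le_le_0_compat; auto.
Qed.

Lemma rsum_Rabs m F : Rabs (rsum m F) <= rsum m (fun i => Rabs (F i)).
Proof.
  induction m as [|m IH]; simpl; [rewrite Rabs_R0; lra|].
  eapply Rle_trans; [apply Rabs_triang|]; lra.
Qed.

Lemma rsum_const m a : rsum m (fun _ => a) = INR m * a.
Proof.
  induction m as [|m IH]; [simpl; ring|]; rewrite S_INR; simpl; rewrite IH; ring.
Qed.

Lemma rsum_dist m F G e : (forall i, (i < m)%nat -> Rabs (F i - G i) <= e) ->
  Rabs (rsum m F - rsum m G) <= INR m * e.
Proof.
  intros H; rewrite <- rsum_const.
  replace (rsum m F - rsum m G) with (rsum m (fun i => F i + -1 * G i))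
    by (rewrite rsum_plus, rsum_scal; ring).
  eapply Rle_trans; [apply rsum_Rabs|]; apply rsum_le; intros i Hi.
  replace (F i + -1 * G i) with (F i - G i) by ring; auto.
Qed.

Lemma rsum_update m F G s : (s < m)%nat ->
  (forall i, (i < m)%nat -> i <> s -> F i = G i) ->
  rsum m F = rsum m G - G s + F s.
Proof.
  induction m as [|m IH]; intros Hs H; [lia|]; simpl.
  destruct (Nat.eq_dec s m) as [->|E].
  - rewrite (rsum_ext m F G); [ring|]; intros; apply H; lia.
  - rewrite IH, (H m); try lia; [ring|]; intros; apply H; lia.
Qed.

Lemma rsum_swap m n (F : nat -> nat -> R) :
  rsum m (fun i => rsum n (F i)) = rsum n (fun j => rsum m (fun i => F i j)).
Proof.
  induction m as [|m IH]; simpl; [symmetry; now apply rsum_zero|].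
  rewrite IH, <- rsum_plus; reflexivity.
Qed.

Lemma rsum_alternating_pairs r (F : nat -> R) :
  rsum (2 * r) (fun l => (-1) ^ l * F l) =
  rsum r (fun i => F (2 * i)%nat - F (2 * i + 1)%nat).
Proof.
  induction r as [|r IH]; [reflexivity|].
  replace (2 * S r)%nat with (S (S (2 * r))) by lia; cbn [rsum]; rewrite IH.
  rewrite pow_1_odd, pow_1_even.
  replace (2 * r + 1)%nat with (S (2 * r)) by lia; ring.
Qed.

(** * The Borsuk-Ulam theorem *)

(** The l1-sphere of dimension [d] inside [n] coordinates. Padding by zeros makes the spheres of
    different dimensions literally nested. *)
Definition sphere (n d : nat) (p : nat -> R) : Prop :=
  rsum n (fun i => Rabs (p i)) = 1 /\ forall i, (d < i)%nat -> p i = 0.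

Definition close_pts (delta : R) (p q : nat -> R) : Prop :=
  forall i, Rabs (p i - q i) < delta.

Definition antipode (p : nat -> R) : nat -> R := fun i => - p i.

(** The point at time [s] on the segment from [p] to the pole of axis [S d]. In the l1 norm this
    segment stays on the sphere, so no normalization is required. *)
Definition join (d : nat) (s : R) (p : nat -> R) : nat -> R :=
  fun i => if Nat.eqb i (S d) then s else (1 - s) * p i.

Lemma antipodeK p : antipode (antipode p) = p.
Proof. apply functional_extensionality; intros i; unfold antipode; ring. Qed.

Lemma map_antipodeK l : map antipode (map antipode l) = l.
Proof.
  induction l as [|p l IH]; simpl; [reflexivity|]; now rewrite antipodeK, IH.
Qed.

Lemma sphere_antipode n d p : sphere n d p -> sphere n d (antipode p).
Proof.
  intros [H1 H2]; split.
  - rewrite <- H1; apply rsum_ext; intros; unfold antipode; apply Rabs_Ropp.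
  - intros i Hi; unfold antipode; rewrite H2; auto; ring.
Qed.

Lemma sphere_mono n d d' p : (d <= d')%nat -> sphere n d p -> sphere n d' p.
Proof. intros Hd [H1 H2]; split; auto; intros; apply H2; lia. Qed.

Lemma close_antipode delta p q : close_pts delta p q -> close_pts delta (antipode p) (antipode q).
Proof.
  intros H i; unfold antipode; replace (- p i - - q i) with (- (p i - q i)) by ring.
  rewrite Rabs_Ropp; apply H.
Qed.

Lemma sphere_coord n d p i : (d < n)%nat -> sphere n d p -> Rabs (p i) <= 1.
Proof.
  intros Hd [H1 H2]; destruct (le_lt_dec n i) as [H|H].
  - rewrite H2 by lia; rewrite Rabs_R0; lra.
  - rewrite <- H1.
    rewrite (rsum_update n _ (fun j => if Nat.eqb j i then 0 else Rabs (p j)) i H).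
    + rewrite Nat.eqb_refl.
      assert (0 <= rsum n (fun j => if Nat.eqb j i then 0 else Rabs (p j))).
      { apply rsum_nonneg; intros j _; destruct (Nat.eqb j i); [lra|apply Rabs_pos]. }
      lra.
    + intros j _ Hj; apply Nat.eqb_neq in Hj; now rewrite Hj.
Qed.

Lemma sphere_join n d s p : (S d < n)%nat -> 0 <= s <= 1 ->
  sphere n d p -> sphere n (S d) (join d s p).
Proof.
  intros Hd Hs [H1 H2]; split.
  - rewrite (rsum_update n _ (fun i => (1 - s) * Rabs (p i)) (S d) Hd).
    + rewrite rsum_scal, H1, (H2 (S d)) by lia.
      unfold join; rewrite Nat.eqb_refl, Rabs_R0, Rabs_pos_eq by lra; ring.
    + intros i _ Hi; unfold join; apply Nat.eqb_neq in Hi; rewrite Hi.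
      rewrite Rabs_mult, (Rabs_pos_eq (1 - s)) by lra; reflexivity.
  - intros i Hi; unfold join.
    replace (Nat.eqb i (S d)) with false by (symmetry; apply Nat.eqb_neq; lia).
    rewrite H2 by lia; ring.
Qed.

Lemma join_0 n d p : sphere n d p -> join d 0 p = p.
Proof.
  intros [_ H]; apply functional_extensionality; intros i; unfold join.
  destruct (Nat.eqb_spec i (S d)) as [->|]; [rewrite H; auto | ring].
Qed.

Lemma join_1 d p q : join d 1 p = join d 1 q.
Proof.
  apply functional_extensionality; intros i; unfold join.
  destruct (Nat.eqb i (S d)); ring.
Qed.

Lemma close_join n d s s' p q delta e : (d < n)%nat -> 0 <= s <= 1 ->
  sphere n d p -> sphere n d q -> close_pts delta p q -> Rabs (s - s') < e ->
  0 < delta -> close_pts (delta + e) (join d s p) (join d s' q).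
Proof.
  intros Hd Hs Hp Hq H He Hdelta i; unfold join.
  destruct (Nat.eqb i (S d)); [lra|].
  replace ((1 - s) * p i - (1 - s') * q i)
    with ((1 - s) * (p i - q i) + - ((s - s') * q i)) by ring.
  eapply Rle_lt_trans; [apply Rabs_triang|].
  rewrite Rabs_Ropp, !Rabs_mult, (Rabs_pos_eq (1 - s)) by lra.
  pose proof (sphere_coord n d q i Hd Hq).
  pose proof (Rabs_pos (s - s')); pose proof (Rabs_pos (q i)).
  pose proof (Rabs_pos (p i - q i)); specialize (H i); nra.
Qed.

(** An odd labelling by [m] absolute values with no complementary pair at distance below [delta]; it
    is the combinatorial trace of an odd map without zeros. *)
Definition admissible (m : nat) (delta : R) (lab : (nat -> R) -> nat * bool) : Prop :=
  forall p, sphere (S m) m p ->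
    (fst (lab p) < m)%nat /\ lab (antipode p) = opp_label (lab p) /\
    forall q, sphere (S m) m q -> close_pts delta p q ->
      fst (lab p) = fst (lab q) -> snd (lab p) = snd (lab q).

Definition fine_simplex (m d : nat) (delta : R) (s : list (nat -> R)) : Prop :=
  length s = S d /\ (forall p, In p s -> sphere (S m) d p) /\
  forall p q, In p s -> In q s -> close_pts delta p q.

Lemma fine_simplex_antipode m d delta s :
  fine_simplex m d delta s -> fine_simplex m d delta (map antipode s).
Proof.
  intros [H1 [H2 H3]]; split; [now rewrite length_map|split].
  - intros p Hp; apply in_map_iff in Hp; destruct Hp as [q [<- Hq]].
    now apply sphere_antipode, H2.
  - intros p q Hp Hq; apply in_map_iff in Hp, Hq.
    destruct Hp as [p' [<- Hp]], Hq as [q' [<- Hq]]; apply close_antipode; auto.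
Qed.

Lemma fine_simplex_prism m d delta e s s' u v :
  (S d <= m)%nat -> 0 <= s <= 1 -> 0 <= s' <= 1 -> Rabs (s - s') < e -> 0 < delta ->
  fine_simplex m d delta u -> In v (prism (join d s) (join d s') u) ->
  fine_simplex m (S d) (delta + e) v.
Proof.
  intros Hd Hs Hs' He Hdelta [H1 [H2 H3]] Hv.
  destruct (in_prism _ _ _ _ Hv) as [Hl Hp].
  split; [now rewrite Hl, H1|]; split.
  - intros p Hpv; destruct (Hp p Hpv) as [x [Hx [-> | ->]]];
      apply sphere_join; auto; lia.
  - assert (He' : Rabs (s' - s) < e) by now rewrite Rabs_minus_sym.
    assert (He0 : forall r, Rabs (r - r) < e).
    { intros r; replace (r - r) with 0 by ring; rewrite Rabs_R0.
      pose proof (Rabs_pos (s - s')); lra. }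
    intros p q Hpv Hqv; destruct (Hp p Hpv) as [x [Hx Ex]].
    destruct (Hp q Hqv) as [y [Hy Ey]].
    destruct Ex as [-> | ->], Ey as [-> | ->];
      apply (close_join (S m)); auto; lia.
Qed.

(** Vertices of a fine simplex are close, hence their labels are coherent, and oddness turns the
    opposite labels into those of the antipodal simplex. *)
Lemma alternating_labels_boundary m d delta lab s : (d <= m)%nat ->
  admissible m delta lab -> fine_simplex m d delta s ->
  face_sum (fun u => alternating m (map lab u)) s =
  xorb (alternating m (map lab s)) (alternating m (map lab (map antipode s))).
Proof.
  intros Hd Hlab [H1 [H2 H3]].
  assert (Hsp : forall p, In p s -> sphere (S m) m p)
    by (intros; apply (sphere_mono _ d); auto).
  replace (map lab (map antipode s)) with (map opp_label (map lab s)).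
  - rewrite <- (face_sum_map lab (alternating m)); apply alternating_boundary.
    + intros x y Hx Hy; apply in_map_iff in Hx, Hy.
      destruct Hx as [p [<- Hp]], Hy as [q [<- Hq]].
      destruct (Hlab p (Hsp p Hp)) as [_ [_ Hc]]; apply Hc; auto.
    + intros x Hx; apply in_map_iff in Hx; destruct Hx as [p [<- Hp]].
      now apply Hlab, Hsp.
  - rewrite !map_map; apply map_ext_in; intros p Hp.
    destruct (Hlab p (Hsp p Hp)) as [_ [-> _]]; reflexivity.
Qed.

(* [h] is a fine hemisphere, obtained by sliding the sphere of dimension [d - 1]
   to a pole.  Its union with its antipode is a cycle which carries an odd
   number of alternating simplices. *)
Lemma hemisphere m d delta : (d <= m)%nat -> (0 < m)%nat -> 0 < delta -> exists h,
  (forall s, In s h -> fine_simplex m d delta s) /\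
  (forall F, eval (face_sum F) (h ++ map (map antipode) h) = false) /\
  (forall lab, admissible m delta lab ->
     eval (fun s => alternating m (map lab s)) (h ++ map (map antipode) h) = true).
Proof.
  intros Hd Hm; revert delta; induction d as [|d IH]; intros delta Hdelta.
  - set (e := fun i => if Nat.eqb i 0 then 1 else 0).
    assert (Hfine : fine_simplex m 0 delta [e]).
    { repeat split.
      - destruct H as [<-|[]].
        rewrite (rsum_update (S m) _ (fun _ => 0) 0); [|lia|].
        + rewrite rsum_zero by auto; unfold e; simpl; rewrite Rabs_R1; ring.
        + intros i _ Hi; unfold e; apply Nat.eqb_neq in Hi; rewrite Hi; apply Rabs_R0.
      - intros i Hi; destruct H as [<-|[]]; unfold e.
        apply Nat.neq_0_lt_0, Nat.eqb_neq in Hi; now rewrite Hi.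
      - intros p q [<-|[]] [<-|[]] i; replace (e i - e i) with 0 by ring.
        now rewrite Rabs_R0. }
    exists [[e]]; split; [|split].
    + intros s [<-|[]]; exact Hfine.
    + intros F; simpl; btauto.
    (* The only face of a point is the empty list, which is alternating; so exactly one of the two
       antipodal points carries an alternating label. *)
    + intros lab Hlab; simpl.
      pose proof (alternating_labels_boundary m 0 delta lab [e] Hd Hlab Hfine) as E.
      simpl in E; rewrite alternating_nil in E.
      rewrite xorb_false_r; now rewrite <- E.
  - destruct (IH ltac:(lia) (delta / 2) ltac:(lra)) as [h [Hh [Hcyc Hodd]]].
    set (s := h ++ map (map antipode) h) in *.
    assert (Hs : forall u, In u s -> fine_simplex m d (delta / 2) u).
    { intros u Hu; apply in_app_or in Hu; destruct Hu as [Hu|Hu]; auto.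
      apply in_map_iff in Hu; destruct Hu as [v [<- Hv]].
      apply fine_simplex_antipode; auto. }
    (* Sliding in [K] steps of size [/ INR K] adds less than [delta / 2] to the mesh [delta / 2] of
       [s]. *)
    destruct (archimed_cor1 (delta / 2) ltac:(lra)) as [K [HK HK0]].
    assert (HKR : 0 < INR K) by now apply lt_0_INR.
    set (f := fun j => join d (INR j / INR K)).
    set (h' := concat (map (fun j => flat_map (prism (f j) (f (S j))) s) (seq 0 K))).
    assert (Hh' : forall u, In u h' -> fine_simplex m (S d) delta u).
    { intros v Hv; apply in_concat in Hv; destruct Hv as [w [Hw Hv]].
      apply in_map_iff in Hw; destruct Hw as [j [<- Hj]].
      apply in_seq in Hj; apply in_flat_map in Hv; destruct Hv as [u [Hu Hv]].
      assert (B : forall i, (i <= K)%nat -> 0 <= INR i / INR K <= 1).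
      { intros i Hi; apply le_INR in Hi; pose proof (pos_INR i); split.
        - apply Rle_mult_inv_pos; auto.
        - apply Rmult_le_reg_r with (INR K); auto.
          unfold Rdiv; rewrite Rmult_assoc, Rinv_l; lra. }
      replace delta with (delta / 2 + delta / 2) by lra.
      apply (fine_simplex_prism m d _ _ (INR j / INR K) (INR (S j) / INR K) u);
        auto; try (apply B; lia); try lra.
      replace (INR j / INR K - INR (S j) / INR K) with (- / INR K)
        by (rewrite S_INR; field; lra).
      rewrite Rabs_Ropp, Rabs_pos_eq; auto.
      apply Rlt_le, Rinv_0_lt_compat; auto. }
    (* At the last level all vertices sit at the pole, so a simplex and its antipode become the same
       list and cancel; at level 0 the join is the identity. *)
    assert (Hbd : forall F, eval (face_sum F) h' = eval F s).
    { intros F; unfold h'; rewrite steps_boundary by auto.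
      rewrite (eval_ext_in (fun u => F (map (f O) u)) F).
      - replace (eval (fun u => F (map (f K) u)) s) with false; [btauto|].
        unfold s; rewrite eval_app, eval_map.
        rewrite (eval_ext_in (fun u => F (map (f K) (map antipode u)))
                             (fun u => F (map (f K) u))); [btauto|].
        intros u _; rewrite map_map; f_equal; apply map_ext; intros p.
        unfold f; replace (INR K / INR K) with 1 by (field; lra); apply join_1.
      - intros u Hu; f_equal; rewrite <- (map_id u) at 2; apply map_ext_in.
        intros p Hp; unfold f; replace (INR 0 / INR K) with 0 by (simpl; field; lra).
        destruct (Hs u Hu) as [_ [H _]]; apply (join_0 (S m)); auto. }
    exists h'; split; [exact Hh'|split].
    (* The antipodal hemisphere is bounded by the antipode of [s], which is [s] with its two halves
       exchanged. *)
    + intros F; rewrite eval_app, eval_map, Hbd.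
      rewrite (eval_ext_in _ (face_sum (fun u => F (map antipode u))) h')
        by (intros; apply face_sum_map).
      rewrite Hbd; unfold s; rewrite !eval_app, !eval_map.
      rewrite (eval_ext_in (fun u => F (map antipode (map antipode u))) F h)
        by (intros; now rewrite map_antipodeK).
      btauto.
    (* Summing Fan's identity over [h'] turns the count on the new sphere into the count on the
       boundary [s], odd by induction. *)
    + intros lab Hlab; rewrite eval_app, eval_map, <- eval_xorb.
      rewrite (eval_ext_in _ (face_sum (fun u => alternating m (map lab u))) h').
      * rewrite Hbd; apply Hodd.
        intros p Hp; destruct (Hlab p Hp) as [A [B C]]; split; [|split]; auto.
        intros q Hq Hpq; apply C; auto; intros i; specialize (Hpq i); lra.
      * intros u Hu; symmetry.
        apply (alternating_labels_boundary m (S d) delta); auto.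
Qed.

(** Otherwise the first coordinate of [G p] exceeding [eta] in absolute value, with its sign, is an
    admissible label. Some simplex with [m + 1] vertices is then alternating, although there are
    only [m] absolute values. *)
Lemma borsuk_ulam_approx m (G : (nat -> R) -> nat -> R) delta eta :
  0 < delta -> 0 < eta ->
  (forall p i, G (antipode p) i = - G p i) ->
  (forall p q i, sphere (S m) m p -> sphere (S m) m q -> close_pts delta p q ->
     (i < m)%nat -> Rabs (G p i - G q i) < eta) ->
  exists p, sphere (S m) m p /\ forall i, (i < m)%nat -> Rabs (G p i) <= eta.
Proof.
  intros Hdelta Heta Hodd Huc.
  destruct (Nat.eq_dec m 0) as [->|Hm].
  { exists (fun i => if Nat.eqb i 0 then 1 else 0); split; [split|].
    - simpl; rewrite Rabs_R1; ring.
    - intros [|i] Hi; [lia|reflexivity].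
    - intros; lia. }
  apply NNPP; intros Hno.
  assert (Hbig : forall p, sphere (S m) m p ->
            exists i, (i < m)%nat /\ eta < Rabs (G p i)).
  { intros p Hp; apply NNPP; intros H; apply Hno; exists p; split; auto.
    intros i Hi; apply Rnot_lt_le; intros Hlt; apply H; exists i; auto. }
  set (test := fun p i => if Rlt_dec eta (Rabs (G p i)) then true else false).
  set (idx := fun p => match find (test p) (seq 0 m) with Some i => i | None => O end).
  set (lab := fun p => (idx p, if Rlt_dec 0 (G p (idx p)) then true else false)).
  assert (Hidx : forall p, sphere (S m) m p ->
            (idx p < m)%nat /\ eta < Rabs (G p (idx p))).
  { intros p Hp; unfold idx; destruct (find (test p) (seq 0 m)) as [i|] eqn:E.
    - apply find_some in E; destruct E as [Hi Ht]; apply in_seq in Hi.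
      unfold test in Ht; destruct (Rlt_dec eta (Rabs (G p i))); [|discriminate].
      split; auto; lia.
    - destruct (Hbig p Hp) as [i [Hi Hl]].
      assert (Hin : In i (seq 0 m)) by (apply in_seq; lia).
      apply (find_none _ _ E) in Hin; unfold test in Hin.
      destruct (Rlt_dec eta (Rabs (G p i))); [discriminate|lra]. }
  assert (Hlab : admissible m delta lab).
  { intros p Hp; destruct (Hidx p Hp) as [Hi Hl]; split; [exact Hi|split].
    - assert (E : idx (antipode p) = idx p).
      { unfold idx; replace (test (antipode p)) with (test p); [reflexivity|].
        apply functional_extensionality; intros i; unfold test.
        now rewrite Hodd, Rabs_Ropp. }
      unfold lab, opp_label; rewrite E; simpl; f_equal; rewrite Hodd.
      unfold Rabs in Hl; destruct (Rcase_abs (G p (idx p)));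
        destruct (Rlt_dec 0 (- G p (idx p))), (Rlt_dec 0 (G p (idx p)));
        simpl; auto; lra.
    (* Opposite signs would put the two values more than [2 * eta] apart, against [Huc]. *)
    - intros q Hq Hpq E; simpl in *.
      destruct (Hidx q Hq) as [_ Hl']; rewrite <- E in *.
      specialize (Huc p q (idx p) Hp Hq Hpq Hi).
      unfold Rabs in *; destruct (Rcase_abs (G p (idx p)));
        destruct (Rcase_abs (G q (idx p)));
        destruct (Rcase_abs (G p (idx p) - G q (idx p)));
        destruct (Rlt_dec 0 (G p (idx p))), (Rlt_dec 0 (G q (idx p)));
        simpl; auto; lra. }
  destruct (hemisphere m m delta (le_n m) ltac:(lia) Hdelta) as [h [Hh [_ Ho]]].
  destruct (eval_true _ _ (Ho lab Hlab)) as [s [Hs Halt]].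
  apply alternating_length in Halt; rewrite length_map in Halt.
  assert (fine_simplex m m delta s) as [Hlen _].
  { apply in_app_or in Hs; destruct Hs as [Hs|Hs]; auto.
    apply in_map_iff in Hs; destruct Hs as [u [<- Hu]].
    apply fine_simplex_antipode; auto. }
  lia.
Qed.

(** * Compactness: from approximate zeros to a zero *)

Lemma cluster_subsequence (u : nat -> R) : (forall n, Rabs (u n) <= 1) ->
  exists (l : R) (psi : nat -> nat), (forall n, (n <= psi n)%nat) /\
    Un_cv (fun n => u (psi n)) l.
Proof.
  intros Hu.
  destruct (Bolzano_Weierstrass u (fun x => -1 <= x <= 1)) as [l Hl].
  - apply compact_P3.
  - intros n; specialize (Hu n); apply Rabs_le_between in Hu; lra.
  - assert (H : forall n, exists p, (n <= p)%nat /\ Rabs (u p - l) < / (INR n + 1)).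
    { intros n.
      assert (Hn : 0 < / (INR n + 1))
        by (apply Rinv_0_lt_compat; pose proof (pos_INR n); lra).
      destruct (Hl (disc l (mkposreal _ Hn)) n) as [p [Hp Hd]].
      - exists (mkposreal _ Hn); intros x Hx; exact Hx.
      - exists p; split; auto. }
    apply functional_choice in H; destruct H as [psi Hpsi].
    exists l, psi; split; [intros; apply Hpsi|].
    intros e He; destruct (archimed_cor1 e He) as [K [HK HK0]].
    exists K; intros n Hn; unfold Rdist.
    eapply Rlt_trans; [apply Hpsi|]; eapply Rle_lt_trans; [|exact HK].
    apply Rinv_le_contravar; [now apply lt_0_INR|].
    apply le_INR in Hn; lra.
Qed.

Lemma Un_cv_reindex (u : nat -> R) l (psi : nat -> nat) :
  (forall n, (n <= psi n)%nat) -> Un_cv u l -> Un_cv (fun n => u (psi n)) l.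
Proof.
  intros Hpsi H e He; destruct (H e He) as [K HK]; exists K; intros n Hn.
  apply HK; specialize (Hpsi n); lia.
Qed.

Lemma cluster_subsequence_vector m (u : nat -> nat -> R) :
  (forall n i, (i < m)%nat -> Rabs (u n i) <= 1) ->
  exists (l : nat -> R) (psi : nat -> nat), (forall n, (n <= psi n)%nat) /\
    forall i, (i < m)%nat -> Un_cv (fun n => u (psi n) i) (l i).
Proof.
  induction m as [|m IH]; intros Hu.
  - exists (fun _ => 0), (fun n => n); split; [auto|intros; lia].
  - destruct IH as [l [psi [Hpsi Hl]]]; [intros; apply Hu; lia|].
    destruct (cluster_subsequence (fun n => u (psi n) m)) as [a [chi [Hchi Ha]]].
    { intros; apply Hu; lia. }
    exists (fun i => if Nat.eqb i m then a else l i), (fun n => psi (chi n)); split.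
    + intros n; specialize (Hchi n); specialize (Hpsi (chi n)); lia.
    + intros i Hi; destruct (Nat.eqb_spec i m) as [->|E]; [exact Ha|].
      apply (Un_cv_reindex (fun n => u (psi n) i)); auto; apply Hl; lia.
Qed.

Lemma Un_cv_uniform m (u : nat -> nat -> R) (l : nat -> R) e : 0 < e ->
  (forall i, (i < m)%nat -> Un_cv (fun n => u n i) (l i)) ->
  exists K, forall n i, (K <= n)%nat -> (i < m)%nat -> Rabs (u n i - l i) < e.
Proof.
  intros He; induction m as [|m IH]; intros H; [exists O; intros; lia|].
  destruct IH as [K HK]; [intros; apply H; lia|].
  destruct (H m ltac:(lia) e He) as [K' HK'].
  exists (K + K')%nat; intros n i Hn Hi.
  destruct (Nat.eq_dec i m) as [->|]; [apply HK'; lia | apply HK; lia].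
Qed.

Theorem borsuk_ulam m (G : (nat -> R) -> nat -> R) :
  (forall p i, G (antipode p) i = - G p i) ->
  (forall eta, 0 < eta -> exists delta, 0 < delta /\
     forall p q i, sphere (S m) m p -> sphere (S m) m q -> close_pts delta p q ->
       (i < m)%nat -> Rabs (G p i - G q i) < eta) ->
  exists p, sphere (S m) m p /\ forall i, (i < m)%nat -> G p i = 0.
Proof.
  intros Hodd Huc.
  assert (Happ : forall n, exists p, sphere (S m) m p /\
            forall i, (i < m)%nat -> Rabs (G p i) <= / (INR n + 1)).
  { intros n.
    assert (Hn : 0 < / (INR n + 1))
      by (apply Rinv_0_lt_compat; pose proof (pos_INR n); lra).
    destruct (Huc _ Hn) as [delta [Hdelta H]].
    now apply (borsuk_ulam_approx m G delta). }
  apply functional_choice in Happ; destruct Happ as [u Hu].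
  destruct (cluster_subsequence_vector (S m) u) as [l0 [psi [Hpsi Hl0]]].
  { intros n i _; apply (sphere_coord (S m) m); auto; apply Hu. }
  (* [l0] is controlled only up to index [m]; beyond it the sphere demands 0. *)
  set (l := fun i => if Nat.leb i m then l0 i else 0).
  assert (Hl : forall i, (i < S m)%nat -> Un_cv (fun n => u (psi n) i) (l i)).
  { intros i Hi; unfold l.
    replace (Nat.leb i m) with true by (symmetry; apply Nat.leb_le; lia); auto. }
  assert (Hclose : forall e, 0 < e -> exists K, forall n, (K <= n)%nat ->
            close_pts e (u (psi n)) l).
  { intros e He; destruct (Un_cv_uniform (S m) _ l e He Hl) as [K HK].
    exists K; intros n Hn i; destruct (le_lt_dec i m) as [Hi|Hi].
    - apply HK; lia.
    - destruct (Hu (psi n)) as [[_ H] _]; rewrite H by auto; unfold l.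
      replace (Nat.leb i m) with false by (symmetry; apply Nat.leb_gt; lia).
      rewrite Rminus_0_r, Rabs_R0; auto. }
  assert (Hsl : sphere (S m) m l).
  { split.
    - apply cond_eq; intros e He.
      (* The errors of [S m] coordinates then add up to less than [e]. *)
      assert (He' : 0 < e / (INR (S m) + 1))
        by (apply Rdiv_lt_0_compat; auto; pose proof (pos_INR (S m)); lra).
      destruct (Hclose _ He') as [K HK]; specialize (HK K (le_n K)).
      destruct (Hu (psi K)) as [[H1 _] _]; rewrite <- H1.
      eapply Rle_lt_trans; [apply rsum_dist with (e := e / (INR (S m) + 1))|].
      + intros i _; eapply Rle_trans; [apply Rabs_triang_inv2|].
        rewrite Rabs_minus_sym; apply Rlt_le, HK.
      + pose proof (pos_INR (S m)).
        apply Rmult_lt_reg_r with (INR (S m) + 1); [lra|].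
        replace (INR (S m) * (e / (INR (S m) + 1)) * (INR (S m) + 1))
          with (INR (S m) * e) by (field; lra).
        nra.
    - intros i Hi; unfold l.
      now replace (Nat.leb i m) with false by (symmetry; apply Nat.leb_gt; lia). }
  exists l; split; auto; intros i Hi.
  apply cond_eq; intros e He.
  destruct (Huc (e / 2) ltac:(lra)) as [delta [Hdelta Hd]].
  destruct (Hclose delta Hdelta) as [K HK].
  destruct (archimed_cor1 (e / 2) ltac:(lra)) as [K' [HK' HK0]].
  set (n := psi (K + K')%nat).
  assert (Hn : (K + K' <= n)%nat) by apply Hpsi.
  destruct (Hu n) as [Hs Hsmall]; specialize (Hsmall i Hi).
  specialize (Hd (u n) l i Hs Hsl (HK (K + K')%nat ltac:(lia)) Hi).
  assert (Hle : / (INR n + 1) <= / INR K').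
  { apply Rinv_le_contravar; [now apply lt_0_INR|].
    assert (INR K' <= INR n) by (apply le_INR; lia); lra. }
  replace (G l i - 0) with (- (G (u n) i - G l i) + G (u n) i) by ring.
  eapply Rle_lt_trans; [apply Rabs_triang|]; rewrite Rabs_Ropp; lra.
Qed.

(** * The Hobby-Rice theorem on the circle *)

(* A point [t] of the l1-sphere encodes the step function on [0, 2 PI] that takes
   the value [sign (t j)] on the [j]-th of consecutive intervals of lengths
   [2 PI |t j|]; [signed_variation n W t] is its integral against [dW]. *)
Definition knot (t : nat -> R) (j : nat) : R :=
  2 * PI * rsum j (fun i => Rabs (t i)).

Definition signed_variation (n : nat) (W : R -> R) (t : nat -> R) : R :=
  rsum n (fun j => sign (t j) * (W (knot t (S j)) - W (knot t j))).

Lemma knot_antipode t j : knot (antipode t) j = knot t j.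
Proof.
  unfold knot; f_equal; apply rsum_ext; intros; unfold antipode; apply Rabs_Ropp.
Qed.

Lemma knot_S t j : knot t (S j) = knot t j + 2 * PI * Rabs (t j).
Proof. unfold knot; simpl; ring. Qed.

Lemma knot_mono t i j : (i <= j)%nat -> knot t i <= knot t j.
Proof.
  pose proof PI_RGT_0.
  induction 1 as [|j Hj IH]; [lra|].
  rewrite knot_S; pose proof (Rabs_pos (t j)); nra.
Qed.

Lemma knot_range n d t j : sphere n d t -> (j <= n)%nat -> 0 <= knot t j <= 2 * PI.
Proof.
  intros [H _] Hj; split.
  - replace 0 with (knot t 0) by (unfold knot; simpl; ring); apply knot_mono; lia.
  - replace (2 * PI) with (knot t n) by (unfold knot; rewrite H; ring).
    now apply knot_mono.
Qed.

Lemma knot_close t t' delta j : close_pts delta t t' ->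
  Rabs (knot t j - knot t' j) <= 2 * PI * (INR j * delta).
Proof.
  intros H; unfold knot; pose proof PI_RGT_0.
  rewrite <- Rmult_minus_distr_l, Rabs_mult, (Rabs_pos_eq (2 * PI)) by lra.
  apply Rmult_le_compat_l; [lra|]; apply rsum_dist; intros i _.
  eapply Rle_trans; [apply Rabs_triang_inv2|]; apply Rlt_le, H.
Qed.

Lemma signed_variation_antipode n W t :
  signed_variation n W (antipode t) = - signed_variation n W t.
Proof.
  replace (- signed_variation n W t) with (-1 * signed_variation n W t) by ring.
  unfold signed_variation; rewrite <- rsum_scal; apply rsum_ext; intros j _.
  rewrite !knot_antipode; unfold antipode; rewrite sign_opp; ring.
Qed.

Lemma sign_cases x :
  (x < 0 /\ sign x = -1) \/ (x = 0 /\ sign x = 0) \/ (0 < x /\ sign x = 1).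
Proof.
  destruct (total_order_T x 0) as [[H|H]|H].
  - left; split; auto; now apply sign_eq_m1.
  - right; left; split; auto; subst; apply sign_0.
  - right; right; split; auto; now apply sign_eq_1.
Qed.

(** [sign] jumps at 0, but where the signs of [t j] and [t' j] differ both intervals are short, so
    [W] varies little on each of them. *)
Lemma signed_variation_uniform n d W : (d < n)%nat -> (forall x, continuity_pt W x) ->
  forall eta, 0 < eta -> exists delta, 0 < delta /\ forall t t',
    sphere n d t -> sphere n d t' -> close_pts delta t t' ->
    Rabs (signed_variation n W t - signed_variation n W t') < eta.
Proof.
  intros Hd HW eta Heta; pose proof PI_RGT_0 as HPI; pose proof (pos_INR n) as Hn.
  (* Each of the [n] terms will contribute an error of at most [2 * e]. *)
  set (e := eta / (2 * INR n + 1)).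
  assert (He : 0 < e) by (apply Rdiv_lt_0_compat; lra).
  destruct (@Heine_cor2 W 0 (2 * PI) (fun x _ => HW x) (mkposreal e He)) as [[a Ha] HU].
  simpl in HU.
  (* Both the displacement of a knot and the length of a short interval then stay below the modulus
     [a]. *)
  set (delta := a / (2 * PI * (INR n + 1))).
  assert (HP : 0 < 2 * PI * (INR n + 1)) by (apply Rmult_lt_0_compat; lra).
  assert (Hdelta : 0 < delta) by now apply Rdiv_lt_0_compat.
  assert (Ea : a = 2 * PI * ((INR n + 1) * delta)) by (unfold delta; field; lra).
  exists delta; split; auto; intros t t' Ht Ht' Hc.
  assert (Hk : forall j, (j <= n)%nat -> Rabs (W (knot t j) - W (knot t' j)) < e).
  { intros j Hj; apply HU; [now apply (knot_range n d)|now apply (knot_range n d)|].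
    eapply Rle_lt_trans; [apply (knot_close _ _ delta); auto|].
    rewrite Ea; apply le_INR in Hj; apply Rmult_lt_compat_l; [lra|].
    apply Rmult_lt_compat_r; lra. }
  assert (Hshort : forall u j, sphere n d u -> (j < n)%nat -> Rabs (u j) < delta ->
            Rabs (W (knot u (S j)) - W (knot u j)) < e).
  { intros u j Hu Hj Hs; apply HU; try (apply (knot_range n d); auto; lia).
    rewrite knot_S; replace (knot u j + 2 * PI * Rabs (u j) - knot u j)
      with (2 * PI * Rabs (u j)) by ring.
    rewrite Rabs_mult, Rabs_Rabsolu, Rabs_pos_eq, Ea by lra.
    apply Rmult_lt_compat_l; [lra|]; pose proof (Rabs_pos (u j)); nra. }
  unfold signed_variation.
  eapply Rle_lt_trans; [apply rsum_dist with (e := 2 * e)|].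
  - intros j Hj.
    assert (H1 := Hk (S j) ltac:(lia)); assert (H0 := Hk j ltac:(lia)).
    assert (Hsame : sign (t j) = sign (t' j) \/
                    (Rabs (t j) < delta /\ Rabs (t' j) < delta)).
    { specialize (Hc j); unfold Rabs in *.
      destruct (sign_cases (t j)) as [[? ->]|[[? ->]|[? ->]]],
               (sign_cases (t' j)) as [[? ->]|[[? ->]|[? ->]]]; auto; right;
      destruct (Rcase_abs (t j - t' j)), (Rcase_abs (t j)), (Rcase_abs (t' j)); lra. }
    assert (Hb : forall u x, Rabs (sign u * x) <= Rabs x).
    { intros u x; rewrite Rabs_mult; pose proof (Rabs_pos x).
      destruct (sign_cases u) as [[_ ->]|[[_ ->]|[_ ->]]];
        rewrite ?Rabs_m1, ?Rabs_R0, ?Rabs_R1; lra. }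
    destruct Hsame as [E|[Hs Hs']].
    + rewrite <- E, <- Rmult_minus_distr_l.
      eapply Rle_trans; [apply Hb|].
      replace (W (knot t (S j)) - W (knot t j) - (W (knot t' (S j)) - W (knot t' j)))
        with ((W (knot t (S j)) - W (knot t' (S j))) +
              - (W (knot t j) - W (knot t' j))) by ring.
      eapply Rle_trans; [apply Rabs_triang|]; rewrite Rabs_Ropp; lra.
    + eapply Rle_trans; [apply Rabs_triang|]; rewrite Rabs_Ropp.
      pose proof (Hb (t j) (W (knot t (S j)) - W (knot t j))).
      pose proof (Hb (t' j) (W (knot t' (S j)) - W (knot t' j))).
      pose proof (Hshort t j Ht Hj Hs); pose proof (Hshort t' j Ht' Hj Hs'); lra.
  - replace eta with (e * (2 * INR n + 1)) by (unfold e; field; lra); nra.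
Qed.

(** * Sign changes of a step function *)

Fixpoint last_sign (e : R) (t : nat -> R) (n : nat) : R :=
  match n with
  | O => e
  | S n' => if Req_dec_T (t n') 0 then last_sign e t n' else sign (t n')
  end.

(** Starting from the value taken at the end closes the step function up on the circle, so that a
    change of sign at 0 is counted as well. *)
Lemma last_sign_fixed t n :
  exists e, (e = 1 \/ e = -1) /\ last_sign e t n = e.
Proof.
  assert (H : (forall e, last_sign e t n = e) \/
              exists c, (c = 1 \/ c = -1) /\ forall e, last_sign e t n = c).
  { induction n as [|n IH]; simpl; [now left|].
    destruct (Req_dec_T (t n) 0) as [_|Hn]; [exact IH|right].
    exists (sign (t n)); split; [|auto].
    destruct (sign_cases (t n)) as [[_ ->]|[[? _]|[_ ->]]]; auto; contradiction. }
  destruct H as [H|[c [Hc H]]]; [exists 1 | exists c]; auto.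
Qed.

(* [z 0 < z 1 < ...] are the sign changes of the step function encoded by [t],
   preceded by the value [e]; the last identity is summation by parts. *)
Lemma sign_changes e t n : e = 1 \/ e = -1 -> exists (q : nat) (z : nat -> R),
  (q <= n)%nat /\ (forall l, (l < q)%nat -> 0 <= z l < knot t n) /\
  (forall l l', (l < l')%nat -> (l' < q)%nat -> z l < z l') /\
  last_sign e t n = e * (-1) ^ q /\
  forall W, signed_variation n W t =
    e * ((-1) ^ q * W (knot t n) - W 0 + 2 * rsum q (fun l => (-1) ^ l * W (z l))).
Proof.
  intros He; pose proof PI_RGT_0 as HPI; induction n as [|n IH].
  - exists O, (fun _ => 0); repeat split; try (intros; lia); simpl; [ring|].
    intros W; unfold signed_variation, knot; simpl.
    replace (2 * PI * 0) with 0 by ring; ring.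
  - destruct IH as [q [z [Hq [Hz [Hinc [Hlast HW]]]]]]; simpl last_sign.
    assert (Hk0 : 0 <= knot t n).
    { replace 0 with (knot t 0) by (unfold knot; simpl; ring); apply knot_mono; lia. }
    assert (Hsq : (-1) ^ q = 1 \/ (-1) ^ q = -1).
    { clear; induction q as [|q [IH|IH]]; simpl; [now left| |]; rewrite IH; lra. }
    assert (HSn : forall W, signed_variation (S n) W t = signed_variation n W t +
              sign (t n) * (W (knot t (S n)) - W (knot t n))) by reflexivity.
    destruct (Req_dec_T (t n) 0) as [H0|H0].
    + assert (Ek : knot t (S n) = knot t n).
      { rewrite knot_S, H0, Rabs_R0; ring. }
      exists q, z; rewrite Ek; repeat split; auto; try (now apply Hz).
      intros W; rewrite HSn, Ek, HW; ring.
    + assert (Hlt : knot t n < knot t (S n)).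
      { rewrite knot_S; pose proof (Rabs_pos_lt _ H0); nra. }
      assert (Hcase : sign (t n) = e * (-1) ^ q \/ sign (t n) = - (e * (-1) ^ q)).
      { destruct (sign_cases (t n)) as [[_ ->]|[[? _]|[_ ->]]]; [|contradiction|];
          destruct He as [-> | ->], Hsq as [-> | ->]; lra. }
      (* A nondegenerate interval either continues the current sign or reverses it, and then
         [knot t n] is the next sign change. *)
      destruct Hcase as [E|E].
      * exists q, z; repeat split; auto; try (now apply Hz).
        -- apply Rlt_trans with (knot t n); auto; now apply Hz.
        -- intros W; rewrite HSn, HW, E; ring.
      * exists (S q), (fun l => if Nat.eqb l q then knot t n else z l).
        split; [lia|split; [|split; [|split]]].
        -- intros l Hl; destruct (Nat.eqb_spec l q) as [->|]; [lra|].
           assert (0 <= z l < knot t n) by (apply Hz; lia); lra.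
        -- intros l l' Hl Hl'.
           destruct (Nat.eqb_spec l q); [lia|].
           destruct (Nat.eqb_spec l' q); [apply Hz; lia | apply Hinc; lia].
        -- rewrite E; simpl; ring.
        -- intros W; rewrite HSn, HW, E; simpl rsum; rewrite Nat.eqb_refl.
           rewrite (rsum_ext q (fun l => (-1) ^ l * W (if Nat.eqb l q then knot t n else z l))
                             (fun l => (-1) ^ l * W (z l))).
           ++ simpl; ring.
           ++ intros l Hl; replace (Nat.eqb l q) with false; auto.
              symmetry; apply Nat.eqb_neq; lia.
Qed.

(* The extra function [x], whose variation is the length, excludes the trivial
   solution without sign change. *)
Theorem alternating_quadrature (N : nat) (g : nat -> R -> R) :
  (forall i, (i < N)%nat -> periodic (g i) /\ forall x, continuity_pt (g i) x) ->
  exists (r : nat) (z : nat -> R), (1 <= r)%nat /\ (2 * r <= N + 2)%nat /\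
    (forall l, (l < 2 * r)%nat -> 0 <= z l < 2 * PI) /\
    (forall l l', (l < l')%nat -> (l' < 2 * r)%nat -> z l < z l') /\
    forall i, (i < N)%nat -> rsum (2 * r) (fun l => (-1) ^ l * g i (z l)) = 0.
Proof.
  intros Hg; pose proof PI_RGT_0 as HPI.
  set (W := fun i => if Nat.ltb i N then g i else fun x => x).
  assert (HWg : forall i, (i < N)%nat -> W i = g i).
  { intros i Hi; unfold W; apply Nat.ltb_lt in Hi; now rewrite Hi. }
  assert (HWN : W N = fun x => x).
  { unfold W; now replace (Nat.ltb N N) with false by (symmetry; apply Nat.ltb_irrefl). }
  assert (HW : forall i x, continuity_pt (W i) x).
  { intros i x; unfold W; destruct (Nat.ltb_spec i N) as [Hi|_]; [now apply Hg|].
    apply derivable_continuous_pt, derivable_pt_id. }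
  (* There are [S N] odd equations, one for each [W i] with [i <= N], on the sphere of dimension
     [S N], hence [S (S N)] intervals. *)
  destruct (borsuk_ulam (S N) (fun t i => signed_variation (S (S N)) (W i) t))
    as [t [Ht Hzero]].
  - intros; apply signed_variation_antipode.
  - intros eta Heta.
    assert (H : forall M, exists delta, 0 < delta /\ forall p q i,
      sphere (S (S N)) (S N) p -> sphere (S (S N)) (S N) q -> close_pts delta p q ->
      (i < M)%nat -> Rabs (signed_variation (S (S N)) (W i) p -
                           signed_variation (S (S N)) (W i) q) < eta).
    { induction M as [|M [d1 [Hd1 H1]]]; [exists 1; split; [lra|intros; lia]|].
      destruct (signed_variation_uniform (S (S N)) (S N) (W M) (Nat.lt_succ_diag_r _)
                  (HW M) eta Heta) as [d2 [Hd2 H2]].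
      exists (Rmin d1 d2); split; [now apply Rmin_pos|].
      intros p q i Hp Hq Hpq Hi; destruct (Nat.eq_dec i M) as [->|].
      - apply H2; auto; intros j; eapply Rlt_le_trans; [apply Hpq|apply Rmin_r].
      - apply H1; auto; [|lia]; intros j.
        eapply Rlt_le_trans; [apply Hpq|apply Rmin_l]. }
    apply H.
  - destruct (last_sign_fixed t (S (S N))) as [e [He Hlast]].
    destruct (sign_changes e t (S (S N)) He) as [q [z [Hq [Hz [Hinc [Hl HV]]]]]].
    assert (Hk : knot t (S (S N)) = 2 * PI).
    { destruct Ht as [H _]; unfold knot; rewrite H; ring. }
    rewrite Hk in *.
    (* The sign returns to its initial value [e] after [q] changes, so [q] is even. *)
    assert (Hsq : (-1) ^ q = 1) by (rewrite Hlast in Hl; destruct He; subst; lra).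
    assert (Heven : exists r, q = (2 * r)%nat).
    { destruct (Nat.Even_or_Odd q) as [[r ->]|[r ->]]; [now exists r|].
      rewrite Nat.add_1_r, pow_1_odd in Hsq; lra. }
    destruct Heven as [r ->]; exists r, z.
    assert (Hr : (1 <= r)%nat).
    (* Without sign changes the variation of the identity would be [2 * PI] up to sign. *)
    { destruct r; [|lia]; exfalso.
      assert (H := Hzero N ltac:(lia)); cbv beta in H; rewrite HV, HWN in H.
      simpl in H; destruct He; subst; lra. }
    split; [exact Hr|split; [lia|split; [exact Hz|split; [exact Hinc|]]]].
    intros i Hi; assert (H := Hzero i ltac:(lia)); cbv beta in H.
    rewrite HV, HWg, Hsq in H by auto.
    (* Periodicity cancels the two boundary terms of the summation by parts. *)
    destruct (Hg i Hi) as [Hper _]; specialize (Hper 0).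
    rewrite Rplus_0_l in Hper; rewrite Hper in H.
    destruct He; subst; lra.
Qed.

(** * Linear algebra *)

Lemma in_span_gen N g i : (i < N)%nat -> in_span N g (g i).
Proof.
  intros Hi; exists (fun j => if Nat.eqb j i then 1 else 0); intros x.
  rewrite (rsum_update N _ (fun _ => 0) i Hi).
  - rewrite rsum_zero, Nat.eqb_refl by auto; ring.
  - intros j _ Hj; apply Nat.eqb_neq in Hj; rewrite Hj; ring.
Qed.

Lemma in_span_sub N g f f' a : in_span N g f -> in_span N g f' ->
  in_span N g (fun x => f x - a * f' x).
Proof.
  intros [c Hc] [c' Hc']; exists (fun i => c i + - a * c' i); intros x.
  rewrite Hc, Hc'.
  rewrite (rsum_ext N (fun i => (c i + - a * c' i) * g i x)
             (fun i => c i * g i x + - a * (c' i * g i x))) by (intros; ring).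
  rewrite rsum_plus, rsum_scal; ring.
Qed.

Lemma lin_indep_swap p h s : (s <= p)%nat -> lin_indep (S p) h ->
  lin_indep (S p) (fun i => if Nat.eqb i s then h p else if Nat.eqb i p then h s else h i).
Proof.
  intros Hs H.
  destruct (Nat.eq_dec s p) as [->|Hsp].
  { intros c Hc; apply H; intros x; rewrite <- (Hc x); apply rsum_ext; intros i _.
    destruct (Nat.eqb_spec i p); now subst. }
  intros c Hc.
  set (c' := fun i => if Nat.eqb i s then c p else if Nat.eqb i p then c s else c i).
  assert (Hs' : forall i, (i < S p)%nat -> c' i = 0).
  { apply H; intros x; rewrite <- (Hc x); simpl.
    rewrite (rsum_update p (fun i => c i * _) (fun i => c' i * h i x) s ltac:(lia)).
    - unfold c'; rewrite !Nat.eqb_refl.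
      replace (Nat.eqb p s) with false by (symmetry; apply Nat.eqb_neq; lia); ring.
    - intros i Hi His; unfold c'.
      replace (Nat.eqb i s) with false by (symmetry; apply Nat.eqb_neq; lia).
      now replace (Nat.eqb i p) with false by (symmetry; apply Nat.eqb_neq; lia). }
  intros i Hi; destruct (Nat.eq_dec i s) as [->|His].
  - rewrite <- (Hs' p ltac:(lia)); unfold c'; rewrite Nat.eqb_refl.
    now replace (Nat.eqb p s) with false by (symmetry; apply Nat.eqb_neq; lia).
  - destruct (Nat.eq_dec i p) as [->|Hip].
    + rewrite <- (Hs' s ltac:(lia)); unfold c'; now rewrite Nat.eqb_refl.
    + rewrite <- (Hs' i Hi); unfold c'.
      replace (Nat.eqb i s) with false by (symmetry; apply Nat.eqb_neq; lia).
      now replace (Nat.eqb i p) with false by (symmetry; apply Nat.eqb_neq; lia).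
Qed.

Lemma lin_indep_eliminate p h a : lin_indep (S p) h ->
  lin_indep p (fun j x => h j x - a j * h p x).
Proof.
  intros H c Hc.
  set (c' := fun i => if Nat.eqb i p then - rsum p (fun j => c j * a j) else c i).
  assert (Hs' : forall i, (i < S p)%nat -> c' i = 0).
  { apply H; intros x; rewrite <- (Hc x); simpl.
    rewrite (rsum_ext p (fun j => c j * (h j x - a j * h p x))
               (fun j => c' j * h j x + - h p x * (c j * a j))).
    - rewrite rsum_plus, rsum_scal; unfold c' at 2; rewrite Nat.eqb_refl; ring.
    - intros j Hj; unfold c'.
      replace (Nat.eqb j p) with false by (symmetry; apply Nat.eqb_neq; lia); ring. }
  intros i Hi; rewrite <- (Hs' i ltac:(lia)); unfold c'.
  now replace (Nat.eqb i p) with false by (symmetry; apply Nat.eqb_neq; lia).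
Qed.

Lemma lin_indep_pred p h : lin_indep (S p) h -> lin_indep p h.
Proof.
  intros H c Hc.
  set (c' := fun i => if Nat.eqb i p then 0 else c i).
  assert (Hs' : forall i, (i < S p)%nat -> c' i = 0).
  { apply H; intros x; rewrite <- (Hc x); simpl.
    rewrite (rsum_ext p (fun j => c j * h j x) (fun j => c' j * h j x)).
    - unfold c' at 2; rewrite Nat.eqb_refl; ring.
    - intros j Hj; unfold c'.
      now replace (Nat.eqb j p) with false by (symmetry; apply Nat.eqb_neq; lia). }
  intros i Hi; rewrite <- (Hs' i ltac:(lia)); unfold c'.
  now replace (Nat.eqb i p) with false by (symmetry; apply Nat.eqb_neq; lia).
Qed.

(** Gaussian elimination: each chord condition costs at most one dimension. A function violating the
    new condition is moved to position [p] as a pivot and subtracted from the others. *)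
Lemma chord_kernel (a b : nat -> R) m p N g : N = (m + p)%nat -> lin_indep N g ->
  exists h, lin_indep p h /\ forall j, (j < p)%nat ->
    in_span N g (h j) /\ forall i, (i < m)%nat -> h j (a i) = h j (b i).
Proof.
  revert p; induction m as [|m IH]; intros p HN Hg.
  - simpl in HN; subst p; exists g; split; auto; intros j Hj; split.
    + now apply in_span_gen.
    + intros; lia.
  - destruct (IH (S p) ltac:(lia) Hg) as [h [Hh Hker]].
    destruct (classic (exists s, (s <= p)%nat /\ h s (a m) <> h s (b m)))
      as [[s [Hs Hne]]|Hall].
    + pose proof (lin_indep_swap p h s Hs Hh) as Hh'.
      set (h' := fun i => if Nat.eqb i s then h p
                          else if Nat.eqb i p then h s else h i) in *.
      assert (Hker' : forall j, (j < S p)%nat -> in_span N g (h' j) /\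
                forall i, (i < m)%nat -> h' j (a i) = h' j (b i)).
      { intros j Hj; unfold h'.
        destruct (Nat.eqb j s); [apply Hker; lia|].
        destruct (Nat.eqb j p); apply Hker; lia. }
      assert (Hp : h' p (a m) - h' p (b m) <> 0).
      { unfold h'; rewrite Nat.eqb_refl.
        destruct (Nat.eqb_spec p s) as [->|]; lra. }
      exists (fun j x => h' j x -
                (h' j (a m) - h' j (b m)) / (h' p (a m) - h' p (b m)) * h' p x).
      split; [now apply (lin_indep_eliminate p h')|].
      intros j Hj; split.
      * apply in_span_sub; apply Hker'; lia.
      * intros i Hi; destruct (Nat.eq_dec i m) as [->|].
        -- apply Rminus_diag_uniq; field; auto.
        -- destruct (Hker' j ltac:(lia)) as [_ E]; rewrite (E i) by lia.
           destruct (Hker' p ltac:(lia)) as [_ E']; rewrite (E' i) by lia.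
           reflexivity.
    (* All the functions satisfy the new condition; one is dropped to keep the count. *)
    + exists h; split; [now apply lin_indep_pred|].
      intros j Hj; destruct (Hker j ltac:(lia)) as [Hsp E]; split; auto.
      intros i Hi; destruct (Nat.eq_dec i m) as [->|]; [|apply E; lia].
      apply NNPP; intros Hne; apply Hall; exists j; split; auto; lia.
Qed.

Lemma in_span_annihilated N g f n (w z : nat -> R) : in_span N g f ->
  (forall i, (i < N)%nat -> rsum n (fun l => w l * g i (z l)) = 0) ->
  rsum n (fun l => w l * f (z l)) = 0.
Proof.
  intros [c Hc] H.
  rewrite (rsum_ext n _ (fun l => rsum N (fun i => c i * (w l * g i (z l))))).
  - rewrite rsum_swap; apply rsum_zero; intros i Hi.
    rewrite rsum_scal, H by auto; ring.
  - intros l _; rewrite Hc, <- rsum_scal; apply rsum_ext; intros; ring.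
Qed.

(** * Equilevel algebras of chord configurations *)

Lemma smooth_circle_plus_scal f g a : smooth_circle f -> smooth_circle g ->
  smooth_circle (fun x => f x + a * g x).
Proof.
  intros [Hf Hf'] [Hg Hg']; split.
  - intros x; now rewrite (Hf x), (Hg x).
  - intros n x; apply (ex_derive_n_plus f (fun x => a * g x)).
    + apply filter_forall; intros; apply Hf'.
    + apply filter_forall; intros; apply ex_derive_n_scal_l, Hg'.
Qed.

Lemma smooth_circle_span N g f : (forall i, (i < N)%nat -> smooth_circle (g i)) ->
  in_span N g f -> smooth_circle f.
Proof.
  intros Hg [c Hc].
  assert (E : f = fun x => rsum N (fun i => c i * g i x))
    by now apply functional_extensionality.
  subst f; clear Hc; induction N as [|N IH]; simpl.
  - split; [intros x; reflexivity|intros n x; apply ex_derive_n_const].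
  - apply (smooth_circle_plus_scal (fun x => rsum N (fun i => c i * g i x))); auto.
Qed.

Lemma smooth_circle_continuity f x : smooth_circle f -> continuity_pt f x.
Proof.
  intros [_ H]; apply continuity_pt_filterlim.
  apply (ex_derive_continuous f x), (H 1%nat x).
Qed.

Lemma algebraic_on_const eps v : algebraic_on eps (fun _ => v).
Proof.
  (* The polynomial [y - v]. *)
  exists 1%nat, (fun i j => match i, j with O, O => - v | O, S _ => 1 | _, _ => 0 end).
  split.
  - exists O, 1%nat; repeat split; auto; lra.
  - intros t _; unfold poly2; simpl; ring.
Qed.

(** The constant curve at [c] defines the algebra, and the constant family at [f] shows that [f]
    lies in it. *)
Lemma equilevel_algebra_of_config k c : in_config k c ->
  exists F, equilevel_algebra k F /\ forall f, alg_of_config k c f -> F f.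
Proof.
  intros Hc; exists (limit_algebra k 1 (fun _ => c)); split.
  - exists 1, (fun _ => c); split; [lra|split; [|split; [auto|reflexivity]]].
    intros j Hj; split; [|split; apply algebraic_on_const].
    intros t0 _ e He; exists 1; split; [lra|]; intros t _ _.
    now rewrite Rminus_diag, Rabs_R0.
  - intros f Hf; split; [apply Hf|]; exists (fun _ => f).
    split; [intros; apply Hf|split; [|split; auto]].
    intros t0 _ e He; exists 1; split; [lra|]; intros t _ _ r x _.
    now rewrite Rminus_diag, Rabs_R0.
Qed.

Lemma in_config_increasing k c :
  (forall l, (l < 2 * k)%nat -> 0 <= c l < 2 * PI) ->
  (forall l l', (l < l')%nat -> (l' < 2 * k)%nat -> c l < c l') -> in_config k c.
Proof.
  intros Hr Hinc i j Hi Hj Hij n E; pose proof PI_RGT_0 as HPI.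
  pose proof (Hr i Hi); pose proof (Hr j Hj).
  assert (n = 0%Z).
  { assert (-1 < IZR n < 1) as [H1 H2] by (split; nra).
    apply lt_IZR in H1, H2; lia. }
  subst n; rewrite Rmult_0_r in E.
  destruct (Nat.lt_total i j) as [H'|[H'|H']]; [|contradiction|];
    apply Hinc in H'; auto; lra.
Qed.

(** The sign changes may be too few for [k] chords; equally spaced points to the right of the last
    one supply the missing ends. *)
Lemma extend_increasing q n b (z : nat -> R) : (1 <= q)%nat ->
  (forall l, (l < q)%nat -> 0 <= z l < b) ->
  (forall l l', (l < l')%nat -> (l' < q)%nat -> z l < z l') ->
  exists c, (forall l, (l < q)%nat -> c l = z l) /\
    (forall l, (l < n)%nat -> 0 <= c l < b) /\
    (forall l l', (l < l')%nat -> (l' < n)%nat -> c l < c l').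
Proof.
  intros Hq Hz Hinc.
  set (y := z (q - 1)%nat).
  assert (Hy : 0 <= y < b) by (apply Hz; lia).
  (* The shift by [q - 1] makes [w] start at [y], and the denominator [n + 1] keeps [w l] below [b]
     for [l < n]. *)
  set (w := fun l => y + (b - y) * (INR (l - (q - 1)) / INR (n + 1))).
  assert (Hn : 0 < INR (n + 1)) by (apply lt_0_INR; lia).
  assert (Hw : forall l, (l < n)%nat -> y <= w l < b).
  { intros l Hl; unfold w.
    assert (0 <= INR (l - (q - 1)) / INR (n + 1) < 1).
    { split; [apply Rle_mult_inv_pos; auto; apply pos_INR|].
      apply Rmult_lt_reg_r with (INR (n + 1)); auto.
      unfold Rdiv; rewrite Rmult_assoc, Rinv_l, Rmult_1_r, Rmult_1_l by lra.
      apply lt_INR; lia. }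
    nra. }
  assert (Hwinc : forall l l', (q - 1 <= l)%nat -> (l < l')%nat -> w l < w l').
  { intros l l' Hl Hll; unfold w.
    apply Rplus_lt_compat_l, Rmult_lt_compat_l; [lra|].
    apply Rmult_lt_compat_r; [now apply Rinv_0_lt_compat|]; apply lt_INR; lia. }
  assert (Hwq : w (q - 1)%nat = y).
  { unfold w; rewrite Nat.sub_diag; simpl; field; lra. }
  exists (fun l => if Nat.ltb l q then z l else w l); split; [|split].
  - intros l Hl; apply Nat.ltb_lt in Hl; now rewrite Hl.
  - intros l Hl; destruct (Nat.ltb_spec l q); [now apply Hz|].
    pose proof (Hw l Hl); lra.
  - intros l l' Hl Hl'.
    destruct (Nat.ltb_spec l q), (Nat.ltb_spec l' q); try lia.
    + now apply Hinc.
    + assert (z l <= y).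
      { destruct (Nat.eq_dec l (q - 1)) as [->|]; [unfold y; lra|].
        apply Rlt_le, Hinc; lia. }
      assert (w (q - 1)%nat < w l') by (apply Hwinc; lia); lra.
    + apply Hwinc; lia.
Qed.

(* L^N = span(g_0,...,g_{N-1}) with g_i smooth on S^1 and linearly independent;
   dim (F cap L^N) > N - k is expressed by N-k+1 linearly independent
   elements of F cap L^N. *)
Theorem mainTheorem14 (k N : nat) (g : nat -> R -> R) :
  (1 <= k)%nat -> (k <= N)%nat -> (N <= 2 * k - 2)%nat ->
  (forall i, (i < N)%nat -> smooth_circle (g i)) ->
  lin_indep N g ->
  exists F : (R -> R) -> Prop,
    equilevel_algebra k F /\
    exists h : nat -> R -> R,
      (forall j, (j < N - k + 1)%nat -> F (h j) /\ in_span N g (h j)) /\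
      lin_indep (N - k + 1) h.
Proof.
  intros Hk HkN HN Hg Hind.
  destruct (alternating_quadrature N g) as [r [z [Hr [HrN [Hz [Hinc Hquad]]]]]].
  { intros i Hi; split; [apply (Hg i Hi)|].
    intros x; now apply smooth_circle_continuity, Hg. }
  destruct (extend_increasing (2 * r) (2 * k) (2 * PI) z ltac:(lia) Hz Hinc)
    as [c [Hcz [Hc Hcinc]]].
  destruct (equilevel_algebra_of_config k c (in_config_increasing k c Hc Hcinc))
    as [F [HF HcF]].
  exists F; split; auto.
  (* Only the chords with indices 1 to [k - 1] are imposed, whence the dimension [N - k + 1]; chord
     0 has to follow from them. *)
  destruct (chord_kernel (fun i => c (2 * S i)%nat) (fun i => c (2 * S i + 1)%nat)
              (k - 1) (N - k + 1) N g ltac:(lia) Hind) as [h [Hh Hker]].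
  exists h; split; auto; intros j Hj; destruct (Hker j Hj) as [Hspan Hchord].
  split; auto; apply HcF; split; [now apply (smooth_circle_span N g)|].
  assert (Hpos : forall i, (1 <= i)%nat -> (i < k)%nat ->
            h j (c (2 * i)%nat) = h j (c (2 * i + 1)%nat)).
  { intros [|i] H1 Hi; [lia|]; apply (Hchord i); lia. }
  intros [|i] Hi; [|apply Hpos; lia].
  (* The first chord is minus the sum of the [r - 1] following ones on [L^N]. *)
  pose proof (in_span_annihilated N g (h j) (2 * r) (fun l => (-1) ^ l) z Hspan Hquad)
    as Hsum; cbv beta in Hsum.
  rewrite (rsum_alternating_pairs r (fun l => h j (z l))) in Hsum.
  rewrite (rsum_update r _ (fun _ => 0) 0 ltac:(lia)) in Hsum.
  - rewrite rsum_zero in Hsum by auto.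
    rewrite !Hcz by lia; simpl in *; lra.
  - intros i Hir Hi0; rewrite <- !Hcz by lia.
    rewrite (Hpos i) by lia; ring.
Qed.
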